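(* For any $n\in\mathbb{N}$ and any pair of convex bodies $K, B\subset\mathbb{R}^n$ that are symmetric with respect to the origin, one has \[ \hat{M}(K,B)\le \hat{M}\big(B^{\circ}, K^{\circ}/2\big)^2 . \]
   Context: For a set $A\subset\mathbb{R}^n$, $A^{\circ}:=\{u\in\mathbb{R}^n:\sup_{x\in A}\langle x,u\rangle\le 1\}$ is its polar body. For a set $K$ and a symmetric convex body $B$, the convex separation (convexified packing) number is \[\hat{M}(K,B):=\sup\{N:\ \exists\, x_1,\dots,x_N\in K \text{ such that } (x_j+\mathrm{int}\,B)\cap \mathrm{conv}\{x_i: i<j\}=\emptyset \text{ for all } j=1,\dots,N\},\] where $\mathrm{int}$ denotes interior and $\mathrm{conv}$ the convex hull; the value $+\infty$ is allowed. For $t>0$, $tB$ and $B/t$ denote dilates. *)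

(* Defs.v *)
From HB Require Import structures.
From mathcomp Require Import all_boot all_order all_algebra.
From mathcomp Require Import all_classical all_reals all_analysis.
Set Implicit Arguments. Unset Strict Implicit. Unset Printing Implicit Defensive.
Import Order.TTheory GRing.Theory Num.Theory.
Import numFieldNormedType.Exports.
Local Open Scope classical_set_scope.
Local Open Scope ring_scope.

(* R^n is modelled as row vectors 'rV[R]_n, with its library (max-norm)
   topology; the topology, hence interior/compactness, is the standard one. *)

Definition dotv (R : realType) (n : nat) (x u : 'rV[R]_n) : R :=
  \sum_(i < n) x ord0 i * u ord0 i.

Definition polar (R : realType) (n : nat) (A : set 'rV[R]_n) : set 'rV[R]_n :=
  [set u | (ereal_sup [set (dotv x u)%:E | x in A] <= 1%:E)%E].

Definition dilate (R : realType) (n : nat) (t : R) (A : set 'rV[R]_n) :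
  set 'rV[R]_n := [set t *: x | x in A].

Definition convhull (R : realType) (n : nat) (A : set 'rV[R]_n) : set 'rV[R]_n :=
  \bigcap_(C in [set C : set (convex_lmodType 'rV[R]_n) | convex_set C /\ A `<=` C]) C.

Definition sym_convex_body (R : realType) (n : nat) (K : set 'rV[R]_n) : Prop :=
  [/\ compact K, convex_set (K : set (convex_lmodType 'rV[R]_n)),
      interior K !=set0 & forall x, K x -> K (- x)].

Definition conv_separated (R : realType) (n : nat) (K B : set 'rV[R]_n)
  (s : seq 'rV[R]_n) : Prop :=
  (forall j, (j < size s)%N -> K (nth 0 s j)) /\
  (forall j, (j < size s)%N ->
     [set nth 0 s j + y | y in interior B] `&`
     convhull [set nth 0 s i | i in [set i : nat | (i < j)%N]] = set0).

Definition Mhat (R : realType) (n : nat) (K B : set 'rV[R]_n) : \bar R :=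
  ereal_sup [set ((size s)%:R)%:E | s in conv_separated K B].

(* Main.v *)
Require Import Defs.
From HB Require Import structures.
From mathcomp Require Import all_boot all_order all_algebra.
From mathcomp Require Import all_classical all_reals all_analysis.
From mathcomp Require Import lra ring.
Set Implicit Arguments. Unset Strict Implicit. Unset Printing Implicit Defensive.
Import Order.TTheory GRing.Theory Num.Theory.
Import numFieldNormedType.Exports.
Local Open Scope classical_set_scope.
Local Open Scope ring_scope.

(** If x_1, ..., x_N in K are convexly separated with respect to B, Hahn-Banach
    provides y_j in the polar of B with <y_j, x_j - x_i> >= 1 for i < j.  Let
    rho be the maximum of |<x_j, y_j>| and m the integer part of 4 rho.
    The segment [-y_j, y_j] at an index j realising rho contains m + 1 points
    that are separated with respect to half the polar of K.  Sort the indices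
    into m + 1 bins of width 1/2 according to the value <x_j, y_j>: for i < j in
    the same bin, <x_i, y_i - y_j> >= 1/2, so that the y_j of one bin, listed
    backwards, are again separated.  Hence N is at most m + 1 times the size of
    the largest bin. *)

(** * The inner product and the maximum norm *)

Section DotProduct.
Context {R : realType} {n : nat}.
Implicit Types (x y u v : 'rV[R]_n) (a : R).

Lemma dotvC x u : dotv x u = dotv u x.
Proof. by apply: eq_bigr => i _; rewrite mulrC. Qed.

Lemma dotvDl x y u : dotv (x + y) u = dotv x u + dotv y u.
Proof. by rewrite /dotv -big_split/=; apply: eq_bigr => i _; rewrite mxE mulrDl. Qed.

Lemma dotvZl a x u : dotv (a *: x) u = a * dotv x u.
Proof. by rewrite /dotv mulr_sumr; apply: eq_bigr => i _; rewrite mxE mulrA. Qed.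

Lemma dotvNl x u : dotv (- x) u = - dotv x u.
Proof. by rewrite -scaleN1r dotvZl mulN1r. Qed.

Lemma dotvBl x y u : dotv (x - y) u = dotv x u - dotv y u.
Proof. by rewrite dotvDl dotvNl. Qed.

Lemma dotvDr x u v : dotv x (u + v) = dotv x u + dotv x v.
Proof. by rewrite dotvC dotvDl !(dotvC x). Qed.

Lemma dotvZr a x u : dotv x (a *: u) = a * dotv x u.
Proof. by rewrite dotvC dotvZl dotvC. Qed.

Lemma dotvNr x u : dotv x (- u) = - dotv x u.
Proof. by rewrite dotvC dotvNl dotvC. Qed.

Lemma dotvBr x u v : dotv x (u - v) = dotv x u - dotv x v.
Proof. by rewrite dotvDr dotvNr. Qed.

Lemma coord_le_norm x i : `|x ord0 i| <= `|x|.
Proof.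
rewrite [leRHS](_ : _ = mx_norm x)// mx_normrE.
exact: (le_bigmax _ (fun i : 'I_1 * 'I_n => `|x i.1 i.2|) (ord0, i)).
Qed.

(** The coordinate of largest modulus alone already contributes the square of the maximum norm. *)
Lemma norm_sqr_le_dotv x : `|x| ^+ 2 <= dotv x x.
Proof.
have [x0|/mx_norm_neq0[[i j] /= xE]] := eqVneq (mx_norm x) 0.
  rewrite [`|x|]x0 expr0n/=; apply: sumr_ge0 => i _; exact: sqr_ge0.
rewrite [`|x|]xE ord1 real_normK ?num_real// /dotv (bigD1 j)//= -expr2 lerDl.
by apply: sumr_ge0 => k _; exact: sqr_ge0.
Qed.

Lemma dotv_le_norm x u : `|dotv x u| <= n%:R * (`|x| * `|u|).
Proof.
rewrite (le_trans (ler_norm_sum _ _ _))//.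
rewrite mulr_natl -[X in _ *+ X](card_ord n) -sumr_const ler_sum// => i _.
by rewrite normrM ler_pM// coord_le_norm.
Qed.

Lemma continuous_dotv x : continuous (dotv x).
Proof.
apply: continuous_big => [|i _ u]; first exact: add_continuous.
by apply: (@continuousM R _ (cst _) (fun v : 'rV[R]_n => v ord0 i));
  [exact: cst_continuous | exact: coord_continuous].
Qed.

Lemma closed_dotv_le x a : closed [set u | dotv x u <= a].
Proof.
apply: (@preimage_closed _ _ (dotv x) [set t | t <= a]); last exact: closed_le.
by move=> u _; exact: continuous_dotv.
Qed.

Lemma convex_setP (A : set (convex_lmodType 'rV[R]_n)) :
  convex_set A <-> forall x y (t : R), 0 <= t <= 1 -> A x -> A y ->
    A (t *: (x : 'rV[R]_n) + (1 - t) *: (y : 'rV[R]_n)).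
Proof.
split=> [cA x y t t01 Ax Ay|cA x y t /set_mem Ax /set_mem Ay]; last first.
  by apply/mem_set; apply: cA => //; apply/andP; split; [exact: ge0|exact: le1].
have tin : Itv.spec (@Itv.num_sem R) (Itv.Real `[0%Z, 1%Z]) t.
  by rewrite /= /Itv.num_sem/= num_real/= in_itv/=.
exact: set_mem (cA x y (Itv.Def tin) (mem_set Ax) (mem_set Ay)).
Qed.

Lemma polarP (A : set 'rV[R]_n) u : polar A u <-> forall x, A x -> dotv x u <= 1.
Proof.
split=> [Au x Ax|Au].
  by rewrite -lee_fin (le_trans _ Au)//; apply: ereal_sup_ubound; exists x.
by apply: ge_ereal_sup => _ [x Ax <-]; rewrite lee_fin; exact: Au.
Qed.

End DotProduct.

(** * Separation of convex sets by vectors of the polar body *)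

Section Separation.
Context {R : realType} {n : nat}.
Implicit Types (x y u v : 'rV[R]_n) (B C : set 'rV[R]_n).

(* A point y of D whose square norm exceeds the infimum m by less than
   m^2 / (m + M) works: otherwise the point of the segment [y, d] with weight
   m / (m + M) at d has square norm below m. *)
Lemma convex_separation0 (D : set (convex_lmodType 'rV[R]_n)) (delta M : R) :
  convex_set D -> D !=set0 -> 0 < delta ->
  (forall d, D d -> delta <= dotv d d <= M) ->
  exists y, forall d, D d -> 0 < dotv y d.
Proof.
move=> /convex_setP cD [d0 Dd0] delta0 DM.
pose S := [set dotv (d : 'rV[R]_n) d | d in D].
have lbS : lbound S delta by move=> _ [d Dd <-]; have /andP[] := DM d Dd.
have S0 : S !=set0 by exists (dotv (d0 : 'rV[R]_n) d0), d0.
have hiS : has_inf S by split => //; exists delta.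
pose m := inf S.
have m0 : 0 < m by rewrite (lt_le_trans delta0)//; exact: lb_le_inf.
have mS d : D d -> m <= dotv (d : 'rV[R]_n) d.
  by move=> Dd; apply: ge_inf; [exists delta | exists d].
have M0 : 0 < M by have /andP[h1 h2] := DM _ Dd0; lra.
pose s := m / (m + M).
have sE : s * (m + M) = m by rewrite /s mulfVK// gt_eqF// addr_gt0.
have s0 : 0 < s by rewrite divr_gt0// addr_gt0.
have s1 : s < 1 by rewrite /s ltr_pdivrMr ?addr_gt0// mul1r; lra.
have [_ [y Dy <-] ym] := inf_adherent (mulr_gt0 s0 m0) hiS.
exists y => d Dd; rewrite ltNge; apply/negP => yd.
have /mS : D (s *: (d : 'rV[R]_n) + (1 - s) *: (y : 'rV[R]_n)).
  by apply: cD => //; rewrite !ltW.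
have /andP[_ dM] := DM d Dd.
move: ym dM yd; rewrite -/m !dotvDl !dotvDr !dotvZl !dotvZr (dotvC d y).
move: (dotv y y) (dotv d d) (dotv y d) => yy dd yd ym dM yd0.
clearbody s m.
have h1 : s ^+ 2 * dd <= s ^+ 2 * M by rewrite ler_pM2l// exprn_gt0.
have h2 : s * (1 - s) * yd <= 0 by rewrite mulr_ge0_le0// mulr_ge0// ?subr_ge0 ltW.
have h3 : (1 - s) ^+ 2 * yy < (1 - s) ^+ 2 * (m + s * m).
  by rewrite ltr_pM2l// exprn_gt0// subr_gt0.
have h4 : 0 <= s * m * (1 - (1 - s) ^+ 2).
  rewrite mulr_ge0// ?mulr_ge0// ?ltW//; nra.
(* By [h1], [h2], [h3] and this identity, the square norm is below [m - s * m * (1 - (1 - s) ^+ 2)],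
   which is at most [m] by [h4]. *)
have h5 : s ^+ 2 * M = s * m - s ^+ 2 * m by rewrite -{1}sE; ring.
lra.
Qed.

Lemma sym_convex_body_ball B : sym_convex_body B ->
  exists2 r : R, 0 < r & forall v, `|v| < r -> B v.
Proof.
case=> _ /convex_setP cB [x0 /nbhs_ballP[r /= r0 rB]] sB.
exists r => // v vr.
have Bv w : `|w| < r -> B (x0 + w).
  move=> wr; apply: rB; rewrite -ball_normE/=.
  by rewrite opprD addrA subrr add0r normrN.
(* The midpoint of [x0 + v] and the reflection of [x0 - v]. *)
have -> : v = 2^-1 *: (x0 + v) + (1 - 2^-1) *: (- (x0 - v)).
  by apply/rowP => i; rewrite !mxE; field.
by apply: cB; [lra|exact: Bv|apply: sB; apply: Bv; rewrite normrN].
Qed.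

(** Every [w] near [t *: b + v] combines [b], with weight [t], and a point [z] of the ball of radius
    [r]. *)
Lemma interior_convex_ball B (r t : R) b v :
  convex_set (B : set (convex_lmodType 'rV[R]_n)) ->
  (forall w, `|w| < r -> B w) -> 0 <= t < 1 -> B b ->
  `|v| < (1 - t) * r -> interior B (t *: b + v).
Proof.
move=> /convex_setP cB rB /andP[t0 t1] Bb vr.
apply/nbhs_ballP; exists ((1 - t) * r - `|v|) => /=; first by rewrite subr_gt0.
move=> w; rewrite -ball_normE/= => wr.
pose z := (1 - t)^-1 *: (w - t *: b).
have -> : w = t *: b + (1 - t) *: z.
  rewrite /z scalerA mulfV ?scale1r; last by rewrite subr_eq0 gt_eqF.
  by rewrite addrC subrK.
apply: cB => //; first by rewrite t0 ltW.
apply: rB; rewrite /z normrZ ger0_norm ?invr_ge0 ?subr_ge0 ?(ltW t1)//.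
rewrite mulrC ltr_pdivrMr ?subr_gt0// [r * _]mulrC.
have -> : w - t *: b = v - (t *: b + v - w).
  by apply/rowP => i; rewrite !mxE; ring.
by rewrite (le_lt_trans (ler_normB _ _))//; lra.
Qed.

(** The factor [1 + e] serves to make linear inequalities strict at interior points. *)
Lemma interior_scale_gt1 (A : set 'rV[R]_n) x : interior A x ->
  exists2 e : R, 0 < e & A ((1 + e) *: x).
Proof.
move=> /nbhs_ballP[r /= r0 rA].
exists (r / (2 * (1 + `|x|))); first by rewrite divr_gt0// mulr_gt0// ltr_pwDl.
apply: rA; rewrite -ball_normE/=.
rewrite scalerDl scale1r opprD addrA subrr add0r normrN normrZ.
have x1 : 0 < 2 * (1 + `|x|) by rewrite mulr_gt0// ltr_pwDl.
rewrite ger0_norm ?divr_ge0 ?ltW// mulrAC ltr_pdivrMr// ltr_pM2l//.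
by have := normr_ge0 x; lra.
Qed.

(** Closed as an intersection of half-spaces; bounded by [2 / r], as one sees by testing [u] against
    its positive multiple of norm [r / 2], which lies in [B]. *)
Lemma compact_polar B : sym_convex_body B -> compact (polar B).
Proof.
move=> /sym_convex_body_ball[r r0 rB].
apply: bounded_closed_compact; last first.
  rewrite (_ : polar B = \bigcap_(b in B) [set u | dotv b u <= 1]).
    by apply: closed_bigI => b _; exact: closed_dotv_le.
  by apply/seteqP; split=> u /=; [move=> /polarP uB b /uB | move=> uB; apply/polarP].
exists (2 / r); split; first exact: num_real.
move=> M rM u /polarP uB; apply: (le_trans _ (ltW rM)).
have [->|u0] := eqVneq u 0; first by rewrite normr0 divr_ge0// ltW.
have nu0 : 0 < `|u| by rewrite normr_gt0.
have /uB : B ((r / 2 / `|u|) *: u).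
  apply: rB; rewrite normrZ ger0_norm ?divr_ge0 ?(ltW r0)//.
  by rewrite mulfVK ?gt_eqF//; lra.
rewrite dotvZl => h.
have : r / 2 / `|u| * `|u| ^+ 2 <= 1.
  by rewrite (le_trans _ h)// ler_wpM2l ?norm_sqr_le_dotv// !divr_ge0// ltW.
by rewrite expr2 mulrA mulfVK ?gt_eqF// ler_pdivlMr//; nra.
Qed.

(** Shrinking [B] to [t *: B] leaves it at positive distance from [C - x], so [convex_separation0]
    applies to the difference of the two sets; the vector found is then normalised by its supremum
    over [B]. *)
Lemma polar_separation_lt B C x (M t : R) : sym_convex_body B ->
  convex_set (C : set (convex_lmodType 'rV[R]_n)) -> C !=set0 ->
  (forall c, C c -> `|c| <= M) ->
  (forall b, interior B b -> ~ C (x + b)) -> 0 < t < 1 ->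
  exists2 y, polar B y & forall c, C c -> t <= dotv y (x - c).
Proof.
move=> bB cC [c0 Cc0] CM xBC /andP[t0 t1].
have [r r0 rB] := sym_convex_body_ball bB.
case: bB => /compact_bounded[MB [_ /(_ (MB + 1)) BM]] cB _ sB.
have {}BM b : B b -> `|b| <= MB + 1 by apply: BM; rewrite ltrDl.
have /convex_setP cB' := cB.
have /convex_setP cC' := cC.
have B0 : B 0 by apply: rB; rewrite normr0.
pose D : set (convex_lmodType 'rV[R]_n) :=
  [set d | exists c b, [/\ C c, B b & d = c - x - t *: b]].
have [||||y yD] := @convex_separation0 D (((1 - t) * r) ^+ 2)
    (n%:R * ((M + `|x| + (MB + 1)) * (M + `|x| + (MB + 1)))).
- apply/convex_setP => _ _ s s01 [c [b [Cc Bb ->]]] [c' [b' [Cc' Bb' ->]]].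
  exists (s *: c + (1 - s) *: c'), (s *: b + (1 - s) *: b').
  split; [exact: cC'|exact: cB'|].
  by apply/rowP => i; rewrite !mxE; ring.
- by exists (c0 - x - t *: 0), c0, 0.
- by rewrite exprn_gt0// mulr_gt0// subr_gt0.
(* Were [d] shorter than [(1 - t) * r], then [t *: b + d] would be interior to [B], although its
   translate by [x] is the point [c] of [C]. *)
- move=> _ [c [b [Cc Bb ->]]]; set d := c - x - t *: b; apply/andP; split.
    rewrite leNgt; apply/negP => dd.
    apply: (xBC (t *: b + d)); last first.
      by rewrite (_ : x + _ = c)//; apply/rowP => i; rewrite !mxE; ring.
    apply: (interior_convex_ball cB rB _ Bb) => //; first by rewrite (ltW t0).
    rewrite -(@ltr_pXn2r _ 2)// ?nnegrE ?mulr_ge0 ?subr_ge0 ?(ltW t1) ?(ltW r0)//.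
    exact: le_lt_trans (norm_sqr_le_dotv _) dd.
  have dM : `|d| <= M + `|x| + (MB + 1).
    rewrite (le_trans (ler_normB _ _))// lerD//.
      by rewrite (le_trans (ler_normB _ _))// lerD// CM.
    rewrite normrZ gtr0_norm// (le_trans _ (BM _ Bb))// ler_piMl// ltW//.
  rewrite (le_trans (ler_norm _))// (le_trans (dotv_le_norm _ _))//.
  by rewrite ler_wpM2l// ler_pM.
have {}yD c b : C c -> B b -> t * dotv y b < dotv y (c - x).
  move=> Cc Bb; rewrite -subr_gt0 -dotvZr -dotvBr.
  by apply: yD; exists c, b.
have y0 : y != 0.
  apply/eqP => y0; have := yD _ _ Cc0 B0.
  by rewrite y0 -(scale0r 0) !dotvZl !mul0r mulr0 ltxx.
pose S := [set dotv y b | b in B].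
have hS : has_sup S.
  split; first by exists (dotv y 0), 0.
  exists (dotv y (c0 - x) / t) => _ [b Bb <-].
  by rewrite ler_pdivlMr// mulrC ltW// yD.
have S_ub b : B b -> dotv y b <= sup S.
  by move=> Bb; apply: sup_ubound; [case: hS | exists b].
have h0 : 0 < sup S.
  have ny0 : 0 < `|y| by rewrite normr_gt0.
  have /S_ub : B ((r / 2 / `|y|) *: y).
    apply: rB; rewrite normrZ ger0_norm ?divr_ge0 ?(ltW r0)//.
    by rewrite mulfVK ?gt_eqF//; lra.
  apply: lt_le_trans; rewrite dotvZr mulr_gt0 ?divr_gt0//.
  by rewrite (lt_le_trans _ (norm_sqr_le_dotv _))// exprn_gt0.
(* The sign reverses [y], which is positive on [C - x]; the symmetry of [B] keeps the result in the
   polar. *)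
exists (- (sup S)^-1 *: y).
  apply/polarP => b /sB/S_ub; rewrite dotvNr dotvZr mulNr -mulrN dotvC => h.
  by rewrite mulrC ler_pdivrMr// mul1r.
move=> c Cc; rewrite dotvZl mulNr -mulrN -dotvNr opprB mulrC ler_pdivlMr//.
rewrite -ler_pdivlMl//; apply: ge_sup; first by case: hS.
by move=> _ [b Bb <-]; rewrite ler_pdivlMl// ltW// yD.
Qed.

(** Let [t] tend to 1: the vectors found stay in the compact polar, and a cluster point inherits the
    limit inequalities because each defines a closed half-space. *)
Lemma polar_separation B C x (M : R) : sym_convex_body B ->
  convex_set (C : set (convex_lmodType 'rV[R]_n)) ->
  (forall c, C c -> `|c| <= M) ->
  (forall b, interior B b -> ~ C (x + b)) ->
  exists2 y, polar B y & forall c, C c -> 1 <= dotv y (x - c).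
Proof.
move=> bB cC CM xBC.
(* The empty case occurs for the first point of a sequence. *)
have [->|/set0P C0] := eqVneq C set0.
  exists 0 => //; apply/polarP => b _; by rewrite -(scale0r 0) dotvZr mul0r.
(* The shift to [k.+2] keeps the factor strictly between 0 and 1 even for [k = 0]. *)
have yP k : exists y, polar B y /\
    forall c, C c -> 1 - k.+2%:R^-1 <= dotv y (x - c).
  have [|y By yC] := @polar_separation_lt B C x M (1 - k.+2%:R^-1) bB cC C0 CM xBC.
    by rewrite subr_gt0 invf_lt1// ltr1n/= ltrBlDr ltrDl invr_gt0 ltr0n.
  by exists y.
have [y {}yP] := choice yP.
have By : (y @ \oo) (polar B) by exists 0%N => // k _; exact: (yP k).1.
have [p [Bp]] := compact_polar bB (fmap_proper_filter y _) By.
rewrite clusterE => yp.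
exists p => // c Cc; apply/ler_addgt0Pr => e e0.
rewrite -lerBlDr.
have Fe : closed [set u | 1 - e <= dotv u (x - c)].
  rewrite (_ : [set _ | _] = [set u | dotv (c - x) u <= e - 1]).
    exact: closed_dotv_le.
  apply/seteqP; split=> u /=; rewrite -[c - x]opprB dotvNl (dotvC u); lra.
rewrite closure_id in Fe; suff : [set u | 1 - e <= dotv u (x - c)] p by [].
rewrite Fe; apply: yp.
suff : \forall k \near \oo, 1 - e <= dotv (y k) (x - c) by [].
near=> k.
rewrite (le_trans _ ((yP k).2 _ Cc))// lerB//.
rewrite (@le_trans _ _ k.+1%:R^-1)// ?lef_pV2 ?posrE ?ltr0n// ?ler_nat//.
by rewrite ltW//; near: k; exact: near_infty_natSinv_lt (PosNum e0).
Unshelve. all: by end_near. Qed.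

End Separation.

(** * Convexly separated sequences and their duality *)

Section ConvexSeparation.
Context {R : realType} {n : nat}.
Implicit Types (x y u v : 'rV[R]_n) (A B C K : set 'rV[R]_n).

Lemma convhull_sub A C : convex_set (C : set (convex_lmodType 'rV[R]_n)) ->
  A `<=` C -> convhull A `<=` C.
Proof. by move=> cC sAC x; apply. Qed.

Lemma subset_convhull A : A `<=` convhull A.
Proof. by move=> x Ax C [_ sAC]; exact: sAC. Qed.

Lemma convex_convhull A :
  convex_set (convhull A : set (convex_lmodType 'rV[R]_n)).
Proof.
apply/convex_setP => x y t t01 xA yA C [cC sAC].
by have /convex_setP := cC; apply=> //; [exact: xA|exact: yA].
Qed.

(** The half-space of all [c] with [2^-1 <= dotv x (nth 0 s j - c)] contains the earlier points,
    hence their hull, but misses the open translate around the point of index [j]. *)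
Lemma conv_separated_polar K B (s : seq 'rV[R]_n) :
  (forall x, K x -> K (- x)) ->
  (forall j, (j < size s)%N -> polar B (nth 0 s j)) ->
  (forall j, (j < size s)%N -> exists2 x, K x &
     forall i, (i < j)%N -> 2^-1 <= dotv x (nth 0 s j - nth 0 s i)) ->
  conv_separated (polar B) (dilate 2^-1 (polar K)) s.
Proof.
move=> sK sB sep; split=> // j js; have [x Kx xs] := sep j js.
apply/seteqP; split=> // _ [[z zK <-]] szC.
have : 2^-1 <= dotv x (nth 0 s j - (nth 0 s j + z)).
  move: szC; apply: (@convhull_sub _ [set c | 2^-1 <= dotv x (nth 0 s j - c)]).
    apply/convex_setP => c c' t /andP[t0 t1] /=.
    rewrite !dotvBr dotvDr !dotvZr.
    move: (dotv x (nth 0 s j)) (dotv x c) (dotv x c') => a b b' h h'.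
    have : 0 <= t * (a - b - 2^-1) by rewrite mulr_ge0// subr_ge0.
    have : 0 <= (1 - t) * (a - b' - 2^-1) by rewrite mulr_ge0// subr_ge0.
    by lra.
  by move=> _ [i ij <-]; exact: xs.
rewrite opprD addrA subrr add0r dotvNr -dotvNl.
(* The hull gives [2^-1 <= dotv (- x) z], whereas the enlarged point [(1 + e) *: z] forces this
   value below [2^-1]. *)
have [e e0 [w /polarP/(_ _ (sK _ Kx)) wK wE]] := interior_scale_gt1 zK.
have : (1 + e) * dotv (- x) z <= 2^-1.
  by rewrite -dotvZr -wE dotvZr ler_piMr// invr_ge0.
by move: (dotv (- x) z) => a; nra.
Qed.

Lemma pigeonhole_count (T : Type) (f : T -> nat) (p : nat) (s : seq T) :
  (0 < p)%N -> all (fun a => f a < p)%N s ->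
  exists b, (size s <= p * count (fun a => f a == b) s)%N.
Proof.
case: p => // p _ fp.
have -> : size s = (\sum_(b < p.+1) count (fun a => f a == b) s)%N.
  elim: s fp => [_|a s IH /= /andP[ap /IH ->]]; first by rewrite big1.
  rewrite big_split/= -add1n; congr addn.
  rewrite (bigD1 (Ordinal ap))//= eqxx big1// => b ba.
  by case: eqP => // ab; case/eqP: ba; apply: val_inj.
have [|b bmax] := @bigop.eq_bigmax _ (fun b : 'I_p.+1 => count (fun a => f a == b) s).
  by rewrite card_ord.
exists (b : nat); rewrite -bmax -[X in (_ <= X * _)%N](card_ord p.+1) -sum_nat_const.
by apply: leq_sum => c _; exact: leq_bigmax.
Qed.

Lemma polar_scale B y (c : R) : (forall b, B b -> B (- b)) ->
  `|c| <= 1 -> polar B y -> polar B (c *: y).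
Proof.
move=> sB c1 /polarP yB; apply/polarP => b Bb; rewrite dotvZr.
rewrite (le_trans (ler_norm _))// normrM mulr_ile1// ler_norml yB//.
by rewrite lerNl -dotvNl yB//; exact: sB.
Qed.

Lemma segment_conv_separated K B x y :
  (forall x, K x -> K (- x)) -> (forall b, B b -> B (- b)) ->
  K x -> polar B y ->
  exists2 t, conv_separated (polar B) (dilate 2^-1 (polar K)) t &
    size t = (Num.trunc (4 * `|dotv x y|)).+1.
Proof.
move=> sK sB Kx By; set m := Num.trunc _.
(* Passing to [- x] does not change [m]. *)
wlog xy0 : x Kx @m / 0 <= dotv x y.
  move=> wl; have [|xy0] := leP 0 (dotv x y); first exact: wl.
  have := wl _ (sK _ Kx); rewrite dotvNl normrN; apply.
  by rewrite oppr_ge0 ltW.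
(* Equally spaced from -1 to 1: neighbours differ by [2 * dotv x y / m%:R] along [x], at least 1/2
   by [mle]. For [m = 0] the quotient is 0 and the only point is [- y]. *)
pose c k : R := 2 * k%:R / m%:R - 1.
exists (mkseq (fun k => c k *: y) m.+1); last by rewrite size_mkseq.
have mle : m%:R <= 4 * dotv x y.
  by rewrite /m ger0_norm// truncn_le mulr_ge0.
apply: conv_separated_polar => // j; rewrite size_mkseq => jm.
  rewrite nth_mkseq//; apply: polar_scale => //.
  have : 0 <= (j%:R / m%:R : R) <= 1.
    rewrite divr_ge0//=; have [->|m0] := posnP m; first by rewrite invr0 mulr0.
    by rewrite ler_pdivrMr ?ltr0n// mul1r ler_nat.
  by rewrite ler_norml /c -mulrA; lra.
exists x => // i ij; rewrite !nth_mkseq//; last exact: ltn_trans jm.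
have m0 : 0 < m%:R :> R by rewrite ltr0n; case: (m) jm ij => //; case: j.
rewrite -scalerBl dotvZr.
have -> : c j - c i = 2 * (j%:R - i%:R) / m%:R by rewrite /c; ring.
rewrite mulrAC ler_pdivlMr//.
have : 1 <= j%:R - i%:R :> R by rewrite lerBrDr nat1r ler_nat.
by move: (j%:R - i%:R) => d; nra.
Qed.

Lemma conv_separated_duality K B (s : seq 'rV[R]_n) :
  sym_convex_body K -> sym_convex_body B -> conv_separated K B s ->
  exists t t' : seq 'rV[R]_n,
    [/\ conv_separated (polar B) (dilate 2^-1 (polar K)) t,
        conv_separated (polar B) (dilate 2^-1 (polar K)) t' &
        (size s <= size t * size t')%N].
Proof.
move=> [/compact_bounded[M [_ /(_ (M + 1)) KM]] cK _ sK] bB [Ks sep].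
have {}KM c : K c -> `|c| <= M + 1 by apply: KM; rewrite ltrDl.
have sB : forall b, B b -> B (- b) by case: bB.
pose x := nth 0 s.
(* The guard sits under the existential, with default 0, so that [choice] yields a total
   function. *)
have yP j : exists y, (j < size s)%N ->
    polar B y /\ forall i, (i < j)%N -> 1 <= dotv y (x j - x i).
  have [js|_] := ltnP j (size s); last by exists 0.
  pose C := convhull [set x i | i in [set i | (i < j)%N]].
  have CK : C `<=` K.
    by apply: convhull_sub => // _ [i /= ij <-]; apply: Ks; exact: ltn_trans js.
  have [|c /CK|b iB Cb|y By yC] := @polar_separation _ _ B C (x j) (M + 1) bB.
  - exact: convex_convhull.
  - exact: KM.
  - suff : set0 (x j + b) by [].
    by rewrite -(sep _ js); split => //; exists b.
  - by exists y => _; split => // i ij; apply: yC; apply: subset_convhull; exists i.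
have [y {}yP] := choice yP.
pose a j := dotv (x j) (y j).
have [/size0nil->|s0] := posnP (size s).
  by exists [::], [::]; split => //; exact: conv_separated_polar.
have [j0 j0s amax] : exists2 j0, (j0 < size s)%N &
    forall j, (j < size s)%N -> `|a j| <= `|a j0|.
  case: (@arg_maxP _ _ _ (Ordinal s0) xpredT (fun j : 'I_(size s) => `|a j|))
    => // j _ jmax.
  by exists j => // i si; exact: (jmax (Ordinal si)).
have [t sept tE] := segment_conv_separated sK sB (Ks _ j0s) (yP _ j0s).1.
(* Bins start at the least possible value, minus the modulus of [a j0]; the argument is at most 4
   times that modulus, so [size t] bins suffice. *)
pose f j := Num.trunc (2 * (a j + `|a j0|)).
have f0 j : (j < size s)%N -> 0 <= 2 * (a j + `|a j0|).
  by move=> /amax; rewrite ler_norml => /andP[h _]; lra.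
(* Indices are listed decreasingly: a predecessor in the new sequence has a larger index, as needed
   to apply [yP] to it. *)
have [||b bs] := @pigeonhole_count nat f (size t) (rev (iota 0 (size s))).
- by rewrite tE.
- apply/allP => j; rewrite mem_rev mem_iota/= add0n tE ltnS => /amax.
  by rewrite ler_norml => /andP[_ h]; apply: le_truncn; rewrite -/(a j0); lra.
pose l := [seq j <- rev (iota 0 (size s)) | f j == b].
exists t, [seq y j | j <- l]; split => //; last first.
  by rewrite size_map size_filter (leq_trans _ bs)// size_rev size_iota.
have lP k : (k < size l)%N -> (nth 0%N l k < size s)%N /\ f (nth 0%N l k) = b.
  move=> /(mem_nth 0%N); rewrite mem_filter mem_rev mem_iota/= add0n.
  by case/andP => /eqP.
have gtn_trans : transitive gtn by move=> u v w vu uw; exact: ltn_trans uw vu.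
have l_sorted : sorted gtn l.
  by apply: sorted_filter; [exact: gtn_trans|rewrite rev_sorted iota_ltn_sorted].
apply: conv_separated_polar => // k; rewrite size_map => kl;
    rewrite (nth_map 0%N)//.
  by have [/yP[]] := lP _ kl.
have [ks kb] := lP _ kl.
exists (x (nth 0%N l k)); first exact: Ks.
move=> i ik; have il := ltn_trans ik kl; rewrite (nth_map 0%N)//.
have [is_ ib] := lP _ il.
have : (nth 0%N l k < nth 0%N l i)%N.
  exact: (sorted_ltn_nth gtn_trans 0%N l_sorted).
move: (nth 0%N l k) (nth 0%N l i) ks kb is_ ib => j j' js fj j's fj' jj'.
(* This bounds [dotv (x j) (y j - y j')] below by [1 + a j - a j'], and [a j' - a j < 1/2] within
   one bin. *)
have := (yP _ j's).2 _ jj'; rewrite !dotvBr (dotvC (y j')) (dotvC (y j')).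
rewrite -/(a j) -/(a j').
have /andP[+ _] := truncn_itv (f0 _ js); rewrite -/(f j) fj => h.
have := truncnS_gt (2 * (a j' + `|a j0|)); rewrite -/(f j') fj' -[b.+1%:R]natr1 => h'.
by lra.
Qed.

End ConvexSeparation.

Theorem theorem1 (R : realType) (n : nat) (K B : set 'rV[R]_n) :
  sym_convex_body K -> sym_convex_body B ->
  (Mhat K B <=
   Mhat (polar B) (dilate (2^-1) (polar K)) *
   Mhat (polar B) (dilate (2^-1) (polar K)))%E.
Proof.
move=> bK bB; apply: ge_ereal_sup => _ [s sep <-].
have [t [t' [sept sept' st]]] := conv_separated_duality bK bB sep.
apply: (@le_trans _ _ ((size t)%:R%:E * (size t')%:R%:E)%E).
  by rewrite -EFinM lee_fin -natrM ler_nat.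
apply: lee_pmul; rewrite ?lee_fin//; apply: ereal_sup_ubound.
  by exists t.
by exists t'.
Qed.
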